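(* Let $M,p,d\ge 1$ be integers, let $\mathcal{Y}\in\mathbb{R}^{M\times Q_1\times\cdots\times Q_d}$, and for $k=1,\dots,p$ let $\mathcal{X}_k\in\mathbb{R}^{M\times P_{k1}\times\cdots\times P_{kl_k}}$. Let $\boldsymbol{U}_{ki}\in\mathbb{R}^{P_{ki}\times\tilde P_{ki}}$ ($k=1,\dots,p$; $i=1,\dots,l_k$) and $\boldsymbol{V}_i\in\mathbb{R}^{Q_i\times\tilde Q_i}$ ($i=1,\dots,d$) be given matrices. For core tensors $\mathcal{C}_k\in\mathbb{R}^{\tilde P_{k1}\times\cdots\times\tilde P_{kl_k}\times\tilde Q_1\times\cdots\times\tilde Q_d}$ put $$\mathcal{B}_k=\mathcal{C}_k\times_1\boldsymbol{U}_{k1}\times_2\cdots\times_{l_k}\boldsymbol{U}_{kl_k}\times_{l_k+1}\boldsymbol{V}_1\times_{l_k+2}\cdots\times_{l_k+d}\boldsymbol{V}_d .$$ Fix $j\in\{1,\dots,p\}$ and fix the core tensors $\mathcal{C}_k$ for all $k\neq j$. Define $$\boldsymbol{Z}_j=\boldsymbol{X}_{j(1)}\left(\boldsymbol{U}_{jl_j}\otimes\boldsymbol{U}_{j,l_j-1}\otimes\cdots\otimes\boldsymbol{U}_{j1}\right),\qquad \mathcal{R}_j=\mathcal{Y}-\sum_{k\neq j}\mathcal{X}_k*\mathcal{B}_k ,$$ and assume that $\boldsymbol{Z}_j^{\mathtt{T}}\boldsymbol{Z}_j$ and $\boldsymbol{V}_i^{\mathtt{T}}\boldsymbol{V}_i$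 ($i=1,\dots,d$) are invertible. Then the least squares problem $$\min_{\mathcal{C}_j}\ \left\|\boldsymbol{Y}_{(1)}-\sum_{k=1}^{p}\boldsymbol{X}_{k(1)}\boldsymbol{B}_k\right\|_F^2$$ over all $\mathcal{C}_j\in\mathbb{R}^{\tilde P_{j1}\times\cdots\times\tilde P_{jl_j}\times\tilde Q_1\times\cdots\times\tilde Q_d}$ is solved by the tensor $\mathcal{C}_j$ whose reshaped form $\tilde{\mathcal{C}}_j\in\mathbb{R}^{\tilde P_j\times\tilde Q_1\times\cdots\times\tilde Q_d}$, $\tilde P_j=\prod_{i=1}^{l_j}\tilde P_{ji}$, is $$\tilde{\mathcal{C}}_j=\mathcal{R}_j\times_1\left(\boldsymbol{Z}_j^{\mathtt{T}}\boldsymbol{Z}_j\right)^{-1}\boldsymbol{Z}_j^{\mathtt{T}}\times_2\left(\boldsymbol{V}_1^{\mathtt{T}}\boldsymbol{V}_1\right)^{-1}\boldsymbol{V}_1^{\mathtt{T}}\times_3\left(\boldsymbol{V}_2^{\mathtt{T}}\boldsymbol{V}_2\right)^{-1}\boldsymbol{V}_2^{\mathtt{T}}\cdots\times_{d+1}\left(\boldsymbol{V}_d^{\mathtt{T}}\boldsymbol{V}_d\right)^{-1}\boldsymbol{V}_d^{\mathtt{T}} .$$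
   Context: All tensors are real. $\|\cdot\|_F$ is the Frobenius norm and $\otimes$ is the Kronecker product of matrices. Mode product: for $\mathcal{R}\in\mathbb{R}^{I_1\times\cdots\times I_n}$ and $\boldsymbol{A}\in\mathbb{R}^{L\times I_m}$, $\mathcal{R}\times_m\boldsymbol{A}$ is the tensor obtained by replacing mode $m$ of size $I_m$ by a mode of size $L$, with entries $(\mathcal{R}\times_m\boldsymbol{A})_{i_1,\dots,i_{m-1},l,i_{m+1},\dots,i_n}=\sum_{i_m=1}^{I_m}\mathcal{R}_{i_1,\dots,i_n}\boldsymbol{A}_{l,i_m}$. Linearization convention: whenever several modes of sizes $N_1,\dots,N_r$ are merged into a single index, the multi-index $(n_1,\dots,n_r)$ is sent to $1+\sum_{s=1}^{r}(n_s-1)\prod_{t<s}N_t$ (first index varies fastest). Matricization: $\boldsymbol{R}_{(m)}\in\mathbb{R}^{I_m\times\prod_{s\ne m}I_s}$ is the mode-$m$ matricization of $\mathcal{R}$: its row index is the mode-$m$ index and its column index is the linearization of the remaining indices in increasing order of mode. In particular $\boldsymbol{Y}_{(1)}\in\mathbb{R}^{M\times Q}$ and $\boldsymbol{X}_{k(1)}\in\mathbb{R}^{M\times P_k}$, where $Q=\prod_{i=1}^{d} Q_i$, $P_k=\prod_{i=1}^{l_k}P_{ki}$, and the first mode is the sample mode. The matrix $\boldsymbol{B}_k\in\mathbb{R}^{P_k\times Q}$ is the unfolding of $\mathcal{B}_k\in\mathbb{R}^{P_{k1}\times\cdots\times P_{kl_k}\times Q_1\times\cdots\times Q_d}$ whose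 row index linearizes the first $l_k$ modes and whose column index linearizes the last $d$ modes. Contraction product: $\mathcal{X}_k*\mathcal{B}_k\in\mathbb{R}^{M\times Q_1\times\cdots\times Q_d}$ has entries $(\mathcal{X}_k*\mathcal{B}_k)_{m,q_1,\dots,q_d}=\sum_{p_1,\dots,p_{l_k}}(\mathcal{X}_k)_{m,p_1,\dots,p_{l_k}}(\mathcal{B}_k)_{p_1,\dots,p_{l_k},q_1,\dots,q_d}$. Reshaped core: $\tilde{\mathcal{C}}_j$ is the $(d+1)$-mode tensor obtained from $\mathcal{C}_j$ by merging its first $l_j$ modes into a single mode (with the linearization convention above); $\mathcal{C}_j$ is recovered from $\tilde{\mathcal{C}}_j$ by the inverse reshape. *)

(* Defs.v *)
From HB Require Import structures.
From mathcomp Require Import all_boot all_order all_algebra.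
From mathcomp Require Import mxtens reals.

Set Implicit Arguments.
Unset Strict Implicit.
Unset Printing Implicit Defensive.

Import Order.TTheory GRing.Theory Num.Theory.
Local Open Scope ring_scope.

(* The shape of a tensor with n modes is its family of mode sizes I : 'I_n -> nat.
   Modes and indices are 0-based: m : 'I_n stands for mode m + 1, and the comments
   use the usual 1-based mode numbers. *)
Notation midx I := {dffun forall s, 'I_(I s)}.
Notation tensor R I := {ffun midx I -> R}.

Section Shapes.
Variables (m n : nat).

Definition cat_sel (I : 'I_m -> nat) (J : 'I_n -> nat) (u : 'I_m + 'I_n) : nat :=
  match u with inl s => I s | inr s => J s end.

(* the modes of I followed by the modes of J *)
Definition scat (I : 'I_m -> nat) (J : 'I_n -> nat) : 'I_(m + n) -> nat :=
  fun s => cat_sel I J (split s).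

Lemma scatl I J s : scat I J (lshift n s) = I s.
Proof. by rewrite /scat (unsplitK (inl s)). Qed.

Lemma scatr I J s : scat I J (rshift m s) = J s.
Proof. by rewrite /scat (unsplitK (inr s)). Qed.

Definition icat I J (a : midx I) (b : midx J) : midx (scat I J) :=
  finfun (fun s => match split s as u return 'I_(cat_sel I J u) with
                   | inl t => a t
                   | inr t => b t
                   end).

Definition ifst I J (i : midx (scat I J)) : midx I :=
  finfun (fun s => cast_ord (scatl I J s) (i (lshift n s))).

Definition isnd I J (i : midx (scat I J)) : midx J :=
  finfun (fun s => cast_ord (scatr I J s) (i (rshift m s))).

Definition fcat (R : Type) (I I' : 'I_m -> nat) (J J' : 'I_n -> nat)
    (A : forall s, 'M[R]_(I s, I' s)) (B : forall s, 'M[R]_(J s, J' s)) :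
    forall s, 'M[R]_(scat I J s, scat I' J' s) :=
  fun s => match split s as u
                 return 'M[R]_(cat_sel I J u, cat_sel I' J' u) with
           | inl t => A t
           | inr t => B t
           end.

End Shapes.

Definition single (N : nat) : 'I_1 -> nat := fun=> N.

Definition isingle (N : nat) (a : 'I_N) : midx (single N) := finfun (fun=> a).

Section Linearization.
Variables (n : nat) (N : 'I_n -> nat).

(* 0-based form of (n_1, ..., n_r) |-> 1 + \sum_s (n_s - 1) \prod_(t < s) N_t *)
Definition lin_nat (i : midx N) : nat :=
  (\sum_(s < n) i s * \prod_(t < n | t < s) N t)%N.

Lemma lin_prefix (i : midx N) k : (k <= n)%N ->
  (\sum_(s < n | s < k) i s * \prod_(t < n | t < s) N t
     < \prod_(t < n | t < k) N t)%N.
Proof.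
elim: k => [|k IHk] kn; first by rewrite !big_pred0.
rewrite (bigD1 (Ordinal kn)) //= [X in (_ < X)%N](bigD1 (Ordinal kn)) //=.
have E (s : 'I_n) : (s < k.+1)%N && (s != Ordinal kn) = (s < k)%N.
  by rewrite -val_eqE /= ltnS andbC -ltn_neqAle.
rewrite (eq_bigl _ _ E) [X in (_ < _ * X)%N](eq_bigl _ _ E).
apply: (@leq_trans ((i (Ordinal kn)).+1 * \prod_(t < n | t < k) N t)%N).
  by rewrite mulSn addnC ltn_add2r IHk // ltnW.
by rewrite leq_mul2r ltn_ord orbT.
Qed.

Lemma lin_subproof (i : midx N) : (lin_nat i < \prod_(s < n) N s)%N.
Proof.
have all_lt (s : 'I_n) : (s < n)%N = true by exact: ltn_ord.
by have := lin_prefix i (leqnn n); rewrite !(eq_bigl _ _ all_lt).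
Qed.

Definition lin (i : midx N) : 'I_(\prod_(s < n) N s) := Ordinal (lin_subproof i).

Lemma delin_subproof (b : 'I_(\prod_(s < n) N s)) (s : 'I_n) :
  (b %/ \prod_(t < n | t < s) N t %% N s < N s)%N.
Proof.
rewrite ltn_mod; case: (posnP (N s)) => // Ns0.
by move: b; rewrite (bigD1 s) //= Ns0 mul0n => -[].
Qed.

(* the inverse of lin, see linK and delinK *)
Definition delin (b : 'I_(\prod_(s < n) N s)) : midx N :=
  finfun (fun s => Ordinal (delin_subproof b s)).

Lemma digits_sum (x k : nat) : (forall s, 0 < N s)%N -> (k <= n)%N ->
  (\sum_(s < n | s < k) (x %/ \prod_(t < n | t < s) N t %% N s)
                           * \prod_(t < n | t < s) N t
     = x %% \prod_(t < n | t < k) N t)%N.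
Proof.
move=> N0; elim: k => [|k IHk] kn.
  by rewrite big_pred0 // big_pred0 // modn1.
rewrite (bigD1 (Ordinal kn)) //= [in RHS](bigD1 (Ordinal kn)) //=.
have E (s : 'I_n) : (s < k.+1)%N && (s != Ordinal kn) = (s < k)%N.
  by rewrite -val_eqE /= ltnS andbC -ltn_neqAle.
rewrite (eq_bigl _ _ E) [in RHS](eq_bigl _ _ E) IHk 1?ltnW //.
set W := (\prod_(t < n | t < k) N t)%N; set m := N _.
have W0 : (0 < W)%N by rewrite prodn_gt0.
have m0 : (0 < m)%N := N0 _.
rewrite {3}(divn_eq x W) {2}(divn_eq (x %/ W) m).
rewrite mulnDl -mulnA -addnA modnMDl [RHS]modn_small //.
apply: (@leq_trans ((x %/ W %% m).+1 * W)%N).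
  by rewrite mulSn addnC ltn_add2r ltn_mod.
by rewrite leq_mul2r ltn_mod m0 orbT.
Qed.

Lemma delinK : cancel delin lin.
Proof.
move=> b; apply: val_inj => /=; rewrite /lin_nat.
have all_lt (s : 'I_n) : (s < n)%N = true by exact: ltn_ord.
have N0 s : (0 < N s)%N := leq_ltn_trans (leq0n _) (ltn_ord (delin b s)).
have := digits_sum b N0 (leqnn n); rewrite !(eq_bigl _ _ all_lt).
rewrite modn_small => [<-|]; last exact: ltn_ord.
by apply: eq_bigr => s _; rewrite ffunE.
Qed.

Lemma linK : cancel lin delin.
Proof.
have c : #|'I_(\prod_(s < n) N s)| = #|midx N|.
  rewrite card_ord card_dep_ffun foldrE big_map big_enum /=.
  by apply: eq_bigr => s _; rewrite card_ord.
have [g gK Kg] : bijective delin.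
  by apply: inj_card_bij; [exact: can_inj delinK | rewrite c].
by move=> i; rewrite -[in LHS](Kg i) delinK Kg.
Qed.

End Linearization.

Section ModeProduct.
Variables (R : pzRingType) (n : nat).

Definition sset (I : 'I_n -> nat) (m : 'I_n) (L : nat) : 'I_n -> nat :=
  fun s => if s == m then L else I s.

Lemma sset_eq I m L : sset I m L m = L.
Proof. by rewrite /sset eqxx. Qed.

Lemma sset_neq I m L s : s <> m -> sset I m L s = I s.
Proof. by rewrite /sset => /eqP/negPf ->. Qed.

(* j with its mode-m index replaced by a *)
Definition iset (I : 'I_n -> nat) (m : 'I_n) (L : nat)
    (j : midx (sset I m L)) (a : 'I_(I m)) : midx I :=
  finfun (fun s => match @eqP _ s m with
                   | ReflectT e => cast_ord (congr1 I (esym e)) a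
                   | ReflectF ne => cast_ord (sset_neq I L ne) (j s)
                   end).

(* T x_(m+1) A *)
Definition mode_prod (I : 'I_n -> nat) (T : tensor R I) (m : 'I_n) (L : nat)
    (A : 'M[R]_(L, I m)) : tensor R (sset I m L) :=
  [ffun j => \sum_(a < I m) T (iset j a) * A (cast_ord (sset_eq I m L) (j m)) a].

(* transport along an equality of shapes *)
Definition tcast (I J : 'I_n -> nat) (e : forall s, J s = I s)
    (T : tensor R I) : tensor R J :=
  [ffun j : midx J => T (finfun (fun s => cast_ord (e s) (j s)))].

(* the shape reached from I after the products in the first k modes *)
Definition smix (I J : 'I_n -> nat) (k : nat) : 'I_n -> nat :=
  fun s => if (s < k)%N then J s else I s.

Lemma smix_at I J (m : 'I_n) : smix I J m m = I m.
Proof. by rewrite /smix ltnn. Qed.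

Lemma smixS I J (m : 'I_n) s : smix I J m.+1 s = sset (smix I J m) m (J m) s.
Proof.
rewrite /smix /sset ltnS leq_eqVlt -val_eqE.
by case: eqP => //= /val_inj ->.
Qed.

Lemma smix_end I J s : J s = smix I J n s.
Proof. by rewrite /smix ltn_ord. Qed.

Definition mode_step (I J : 'I_n -> nat) (A : forall s, 'M[R]_(J s, I s))
    (m : 'I_n) (T : tensor R (smix I J m)) : tensor R (smix I J m.+1) :=
  tcast (smixS I J m)
    (mode_prod T (castmx (erefl, esym (smix_at I J m)) (A m))).

Fixpoint mode_steps (I J : 'I_n -> nat) (A : forall s, 'M[R]_(J s, I s))
    (T : tensor R I) (k : nat) : (k <= n)%N -> tensor R (smix I J k) :=
  match k with
  | 0 => fun=> T
  | k'.+1 => fun kn =>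
      @mode_step I J A (Ordinal kn) (mode_steps A T (ltnW kn))
  end.

(* T x_1 A_1 x_2 A_2 ... x_n A_n *)
Definition mode_prods (I J : 'I_n -> nat) (T : tensor R I)
    (A : forall s, 'M[R]_(J s, I s)) : tensor R J :=
  tcast (@smix_end I J) (mode_steps A T (leqnn n)).

End ModeProduct.

Section Unfoldings.
Variables (R : pzRingType) (m n : nat).

Definition contract (M : nat) (P : 'I_m -> nat) (Q : 'I_n -> nat)
    (X : tensor R (scat (single M) P)) (B : tensor R (scat P Q)) :
    tensor R (scat (single M) Q) :=
  [ffun i => \sum_(a : midx P) X (icat (ifst i) a) * B (icat a (isnd i))].

(* The mode-1 matricization; a tensor of samples has the sample mode first. *)
Definition mat1 (M : nat) (Q : 'I_n -> nat) (T : tensor R (scat (single M) Q)) :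
    'M[R]_(M, \prod_(s < n) Q s) :=
  \matrix_(a, b) T (icat (isingle a) (delin b)).

Definition unfold (P : 'I_m -> nat) (Q : 'I_n -> nat) (B : tensor R (scat P Q)) :
    'M[R]_(\prod_(s < m) P s, \prod_(s < n) Q s) :=
  \matrix_(a, b) B (icat (delin a) (delin b)).

Definition merge_modes (P : 'I_m -> nat) (Q : 'I_n -> nat) (C : tensor R (scat P Q)) :
    tensor R (scat (single (\prod_(s < m) P s)) Q) :=
  [ffun i => C (icat (delin (ifst i ord0)) (isnd i))].

Definition split_modes (P : 'I_m -> nat) (Q : 'I_n -> nat)
    (C : tensor R (scat (single (\prod_(s < m) P s)) Q)) : tensor R (scat P Q) :=
  [ffun i => C (icat (isingle (lin (ifst i))) (isnd i))].

End Unfoldings.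

Lemma prod_ord_recr n (N : 'I_n.+1 -> nat) :
  (N ord_max * \prod_(s < n) N (widen_ord (leqnSn n) s)
     = \prod_(s < n.+1) N s)%N.
Proof. by rewrite big_ord_recr mulnC. Qed.

(* U_n (x) ... (x) U_1, the empty product being the 1 x 1 identity.  In
   A *t B the index of B varies fastest. *)
Fixpoint rev_kron (R : pzRingType) (n : nat) :
    forall (P P' : 'I_n -> nat) (U : forall s, 'M[R]_(P s, P' s)),
    'M[R]_(\prod_(s < n) P s, \prod_(s < n) P' s) :=
  match n with
  | 0 => fun P P' _ =>
      castmx (esym (big_ord0 _ _ _ _), esym (big_ord0 _ _ _ _)) (1%:M : 'M[R]_1)
  | n'.+1 => fun P P' U =>
      castmx (prod_ord_recr P, prod_ord_recr P')
        (U ord_max *t rev_kron (fun s => U (widen_ord (leqnSn n') s)))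
  end.

Definition frobenius (R : rcfType) (m n : nat) (A : 'M[R]_(m, n)) : R :=
  Num.sqrt (\sum_(i < m) \sum_(j < n) A i j ^+ 2).

(* Main.v *)
(** Unfolding turns the mode products into Kronecker products, so that with
    K = V_d (x) ... (x) V_1 the residual is the matrix R_(1) - Z G K^T, where G
    ranges over the unfoldings of the free core.  By Pythagoras such a bilinear
    least squares problem is solved by any G satisfying the normal equations
    Z^T (R_(1) - Z G K^T) K = 0, and the stated core does since
    Z^T Z (Z^T Z)^-1 Z^T = Z^T and V_i (V_i^T V_i)^-1 V_i^T V_i = V_i. *)
Require Import Defs.
From HB Require Import structures.
From mathcomp Require Import all_boot all_order all_algebra.
From mathcomp Require Import mxtens reals.

Set Implicit Arguments.
Unset Strict Implicit.
Unset Printing Implicit Defensive.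

Import Order.TTheory GRing.Theory Num.Theory.
Local Open Scope ring_scope.

(** * Multi-indices over concatenated shapes *)

Section ConcatenatedIndices.
Variables (m n : nat) (I : 'I_m -> nat) (J : 'I_n -> nat).

(** Passing to values in [nat] makes the match on [split s] non-dependent, so that [split s] can be
    rewritten afterwards. *)
Lemma val_icat (a : midx I) (b : midx J) s :
  val (icat a b s) = match split s with inl t => val (a t) | inr t => val (b t) end.
Proof. by rewrite ffunE; rewrite /scat; case: (split s). Qed.

Lemma icatl (a : midx I) (b : midx J) : ifst (icat a b) = a.
Proof.
by apply/ffunP=> s; apply: val_inj; rewrite ffunE /= val_icat (unsplitK (inl s)).
Qed.

Lemma icatr (a : midx I) (b : midx J) : isnd (icat a b) = b.
Proof.
by apply/ffunP=> s; apply: val_inj; rewrite ffunE /= val_icat (unsplitK (inr s)).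
Qed.

Lemma icat_eta (i : midx (scat I J)) : icat (ifst i) (isnd i) = i.
Proof.
apply/ffunP=> s; apply: val_inj; rewrite val_icat.
case: (split_ordP s) => t ->.
  by rewrite ffunE.
by rewrite ffunE.
Qed.

Lemma sum_icat (R : nmodType) (F : midx (scat I J) -> R) :
  \sum_i F i = \sum_(a : midx I) \sum_(b : midx J) F (icat a b).
Proof.
rewrite pair_big (reindex (fun u : midx I * midx J => icat u.1 u.2)) //=.
exists (fun i => (ifst i, isnd i)) => [[a b]|i] _ /=; last exact: icat_eta.
by rewrite icatl icatr.
Qed.

(** The matrix and both of its indices are dependent matches on the same [split s]; keeping [s]
    general lets one case analysis reduce all three together. *)
Lemma fcat_icat (R : Type) (I' : 'I_m -> nat) (J' : 'I_n -> nat)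
    (A : forall s, 'M[R]_(I s, I' s)) (B : forall s, 'M[R]_(J s, J' s))
    (a : midx I) (b : midx J) (a' : midx I') (b' : midx J') s :
  fcat A B s (icat a b s) (icat a' b' s) =
  match split s with inl t => A t (a t) (a' t) | inr t => B t (b t) (b' t) end.
Proof. by rewrite !ffunE /fcat /scat; case: (split s). Qed.

Lemma prod_fcat (R : pzSemiRingType) (I' : 'I_m -> nat) (J' : 'I_n -> nat)
    (A : forall s, 'M[R]_(I s, I' s)) (B : forall s, 'M[R]_(J s, J' s))
    (a : midx I) (b : midx J) (a' : midx I') (b' : midx J') :
  \prod_s fcat A B s (icat a b s) (icat a' b' s) =
  (\prod_s A s (a s) (a' s)) * \prod_s B s (b s) (b' s).
Proof.
rewrite big_split_ord /=; congr (_ * _); apply: eq_bigr => s _; rewrite fcat_icat.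
  by rewrite (unsplitK (inl s)).
by rewrite (unsplitK (inr s)).
Qed.

End ConcatenatedIndices.

Lemma sum_isingle (R : nmodType) N (F : midx (single N) -> R) :
  \sum_i F i = \sum_(a < N) F (isingle a).
Proof.
rewrite (reindex (fun a : 'I_N => isingle a)) //.
exists (fun i : midx (single N) => i ord0) => [a|i] _; first by rewrite ffunE.
by apply/ffunP=> s; rewrite ffunE (ord1 s).
Qed.

Lemma sum_lin (R : nmodType) n (N : 'I_n -> nat) (F : midx N -> R) :
  \sum_i F i = \sum_(a < \prod_(s < n) N s) F (delin a).
Proof.
rewrite (reindex (@delin n N)) //.
by exists (@lin n N) => i _; [exact: delinK | exact: linK].
Qed.

(** * Closed form of iterated mode products *)

Section ModeProducts.
Variables (R : comPzRingType) (n : nat) (I J : 'I_n -> nat).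
Implicit Types (T : tensor R I) (A : forall s, 'M[R]_(J s, I s)).

Lemma nat_iset (K : 'I_n -> nat) (m : 'I_n) L (j : midx (sset K m L)) (a : 'I_(K m)) s :
  iset j a s = (if s == m then a : nat else j s) :> nat.
Proof. by rewrite ffunE; case: eqP. Qed.

(* The first k entries of i are matched with those of a complete index y, since
   smix I J k carries them only up to a cast. *)
Lemma mode_stepsE T A k (kn : (k <= n)%N) (i : midx (smix I J k)) (y : midx J) :
    (forall s : 'I_n, (s < k)%N -> i s = y s :> nat) ->
  mode_steps A T kn i =
  \sum_(x : midx I | [forall s : 'I_n, (k <= s)%N ==> (x s == i s :> nat)])
     T x * \prod_(s < n | (s < k)%N) A s (y s) (x s).
Proof.
elim: k kn i => [|k IHk] kn i iy /=.
  (* [smix I J 0] is convertible to [I], so [i] can be retyped as an index of [T]; the constraint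
     then forces x = i and the product is empty. *)
  have -> : i = [ffun s => i s] :> midx I by apply/ffunP=> s; rewrite ffunE.
  rewrite (big_pred1 i) => [|x].
    rewrite big_pred0 ?mulr1 //; congr (T _); apply/ffunP=> s; by rewrite ffunE.
  apply/forallP/eqP => [xi|-> s]; last by rewrite ffunE eqxx.
  by apply/ffunP=> s; apply: val_inj; have /eqP := xi s; rewrite ffunE.
set m := Ordinal kn.
rewrite ffunE ffunE.
set i' := [ffun s => _].
have vi' s : i' s = i s :> nat by rewrite ffunE.
have stepE a : mode_steps A T (ltnW kn) (iset i' a) =
    \sum_(x : midx I | [forall s : 'I_n, (k <= s)%N ==> (x s == iset i' a s :> nat)])
       T x * \prod_(s < n | (s < k)%N) A s (y s) (x s).
  apply: IHk => s sk; rewrite nat_iset vi' iy ?(leq_trans sk) //.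
  by rewrite -val_eqE /= ltn_eqF.
under [LHS]eq_bigr => a _.
  rewrite stepE castmxE /= mulr_suml.
  over.
(* Grouping the indices x by their entry in mode [m] recovers the summation variable [a] of the last
   mode product. *)
rewrite (partition_big (fun x : midx I => cast_ord (esym (smix_at I J m)) (x m)) predT) //=.
apply: eq_bigr => a _; apply: eq_big => [x|x].
  apply/forallP/andP => [xi|[/forallP xi /eqP xa] s].
    split.
      apply/forallP=> s; apply/implyP=> ks; have := implyP (xi s) (ltnW ks).
      by rewrite nat_iset vi' -val_eqE /= (gtn_eqF ks).
    apply/eqP/val_inj=> /=; have := implyP (xi m) (leqnn k).
    by rewrite nat_iset eqxx => /eqP.
  apply/implyP=> ks; rewrite nat_iset; case: (s =P m) => [->|/eqP sm].
    by rewrite -xa.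
  rewrite vi'; apply: (implyP (xi s)); rewrite ltn_neqAle ks andbT.
  by move: sm; rewrite -val_eqE eq_sym.
move=> /forallP xi.
have xa : a = cast_ord (esym (smix_at I J m)) (x m).
  apply: val_inj => /=; have := implyP (xi m) (leqnn k).
  by rewrite nat_iset eqxx => /eqP.
rewrite [in RHS](bigD1 m) //= -mulrA; congr (_ * _); rewrite mulrC; congr (_ * _).
  rewrite xa; congr (A m _ _); apply: val_inj => //=.
  by rewrite vi' iy.
apply: eq_bigl => s; rewrite ltnS -val_eqE /= andbC.
by rewrite ltn_neqAle.
Qed.

(** At k = n no mode is constrained any more and every matrix contributes its factor. *)
Lemma mode_prodsE T A (y : midx J) :
  mode_prods T A y = \sum_(x : midx I) T x * \prod_s A s (y s) (x s).
Proof.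
rewrite ffunE (@mode_stepsE _ _ _ _ _ y); last by move=> s _; rewrite ffunE.
apply: eq_big => [x|x _].
  by apply/forallP=> s; rewrite leqNgt ltn_ord.
by congr (_ * _); apply: eq_bigl => s; rewrite ltn_ord.
Qed.

End ModeProducts.

(** * Kronecker products in reverse order *)

(** The last mode is the most significant digit of [lin], and the left factor of [*t] carries the
    slow index; this is why the factors appear in reverse order. *)
Lemma rev_kron_lin (R : comPzRingType) n (P P' : 'I_n -> nat)
    (A : forall s, 'M[R]_(P s, P' s)) (a : midx P) (b : midx P') :
  rev_kron A (lin a) (lin b) = \prod_s A s (a s) (b s).
Proof.
elim: n P P' A a b => [|n IHn] P P' A a b /=.
  by rewrite castmxE mxE [RHS]big_ord0 [cast_ord _ _]ord1 [cast_ord _ (lin b)]ord1.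
pose w := widen_ord (leqnSn n).
have linS (N : 'I_n.+1 -> nat) (i : midx N) :
    cast_ord (esym (prod_ord_recr N)) (lin i)
    = mxtens_index (i ord_max, lin (finfun (fun s => i (w s)) : midx (fun s => N (w s)))).
  apply: val_inj; rewrite /= /lin_nat big_ord_recr /= addnC.
  (* The stride of mode k involves only the modes before it, so for k <= n it never sees the last
     one. *)
  have ltw k (F : 'I_n.+1 -> nat) : (k <= n)%N ->
      (\prod_(t < n.+1 | t < k) F t = \prod_(t < n | t < k) F (w t))%N.
    by move=> kn; rewrite big_mkcond big_ord_recr /= ltnNge kn muln1 -big_mkcond.
  rewrite ltw //; congr (_ * _ + _)%N.
    by apply: eq_bigl => s; rewrite ltn_ord.
  by apply: eq_bigr => s _; rewrite ffunE ltw // ltnW.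
rewrite castmxE !linS tensmxE IHn big_ord_recr /= mulrC.
by congr (_ * _); apply: eq_bigr => s _; rewrite !ffunE.
Qed.

Lemma rev_kronE (R : comPzRingType) n (P P' : 'I_n -> nat)
    (A : forall s, 'M[R]_(P s, P' s)) a b :
  rev_kron A a b = \prod_s A s (delin a s) (delin b s).
Proof. by rewrite -rev_kron_lin !delinK. Qed.

Lemma trmx_rev_kron (R : comPzRingType) n (P P' : 'I_n -> nat)
    (A : forall s, 'M[R]_(P s, P' s)) :
  (rev_kron A)^T = rev_kron (fun s => (A s)^T).
Proof.
apply/matrixP=> a b; rewrite mxE !rev_kronE.
by apply: eq_bigr => s _; rewrite mxE.
Qed.

Lemma mulmx_castmx (R : pzRingType) m m' n n' p p' (em : m = m') (en : n = n')
    (ep : p = p') (A : 'M[R]_(m, n)) (B : 'M[R]_(n, p)) :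
  castmx (em, en) A *m castmx (en, ep) B = castmx (em, ep) (A *m B).
Proof. by case: _ / em; case: _ / en; case: _ / ep. Qed.

(** The mixed-product property of the Kronecker product, iterated over the modes. *)
Lemma rev_kron_mul (R : comPzRingType) n (P P' P'' : 'I_n -> nat)
    (A : forall s, 'M[R]_(P s, P' s)) (B : forall s, 'M[R]_(P' s, P'' s)) :
  rev_kron A *m rev_kron B = rev_kron (fun s => A s *m B s).
Proof.
elim: n P P' P'' A B => [|n IHn] P P' P'' A B /=.
  by rewrite mulmx_castmx mul1mx.
by rewrite mulmx_castmx tensmx_mul IHn.
Qed.

Lemma eq_rev_kron (R : comPzRingType) n (P P' : 'I_n -> nat)
    (A B : forall s, 'M[R]_(P s, P' s)) :
  (forall s, A s = B s) -> rev_kron A = rev_kron B.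
Proof.
move=> AB; apply/matrixP=> a b; rewrite !rev_kronE.
by apply: eq_bigr => s _; rewrite AB.
Qed.

(** * Unfoldings as matrix products *)

Section TensorUnfoldings.
Variables (R : comPzRingType) (m n : nat).

Lemma mode_prods_fcat (I J : 'I_m -> nat) (I' J' : 'I_n -> nat)
    (T : tensor R (scat I I')) (A : forall s, 'M[R]_(J s, I s))
    (B : forall s, 'M[R]_(J' s, I' s)) (a : midx J) (b : midx J') :
  mode_prods T (fcat A B) (icat a b) =
  \sum_(x : midx I) \sum_(y : midx I')
    (\prod_s A s (a s) (x s)) * T (icat x y) * (\prod_s B s (b s) (y s)).
Proof.
rewrite mode_prodsE sum_icat; apply: eq_bigr => x _; apply: eq_bigr => y _.
by rewrite prod_fcat mulrA (mulrC (T _)).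
Qed.

Lemma unfold_mode_prods (I J : 'I_m -> nat) (I' J' : 'I_n -> nat)
    (T : tensor R (scat I I')) (A : forall s, 'M[R]_(J s, I s))
    (B : forall s, 'M[R]_(J' s, I' s)) :
  unfold (mode_prods T (fcat A B)) = rev_kron A *m unfold T *m (rev_kron B)^T.
Proof.
apply/matrixP=> a b; rewrite mxE mode_prods_fcat exchange_big sum_lin mxE.
apply: eq_bigr => y _; rewrite mxE mulr_suml sum_lin.
apply: eq_bigr => x _; rewrite !mxE.
by rewrite !rev_kronE.
Qed.

(** Parallel to [unfold_mode_prods] but not an instance of it: the rows of [mat1] are indexed by
    ['I_M] itself, not by the linearization of a single mode. *)
Lemma mat1_mode_prods M M' (I' J' : 'I_n -> nat)
    (T : tensor R (scat (single M) I')) (A : 'M[R]_(M', M))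
    (B : forall s, 'M[R]_(J' s, I' s)) :
  mat1 (mode_prods T (fcat (I := single M') (I' := single M) (fun=> A) B))
  = A *m mat1 T *m (rev_kron B)^T.
Proof.
apply/matrixP=> a b; rewrite [LHS]mxE mode_prodsE sum_icat exchange_big sum_lin mxE.
apply: eq_bigr => y _; rewrite mxE mulr_suml sum_isingle.
apply: eq_bigr => x _; rewrite prod_fcat big_ord1 !ffunE !mxE mulrA (mulrC (T _)).
by rewrite rev_kronE.
Qed.

Lemma mat1_contract M (P : 'I_m -> nat) (Q : 'I_n -> nat)
    (X : tensor R (scat (single M) P)) (B : tensor R (scat P Q)) :
  mat1 (contract X B) = mat1 X *m unfold B.
Proof.
apply/matrixP=> a b; rewrite !mxE ffunE icatl icatr sum_lin.
by apply: eq_bigr => x _; rewrite !mxE.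
Qed.

Lemma unfold_split_modes (P : 'I_m -> nat) (Q : 'I_n -> nat)
    (C : tensor R (scat (single (\prod_(s < m) P s)) Q)) :
  unfold (split_modes C) = mat1 C.
Proof. by apply/matrixP=> a b; rewrite !mxE ffunE icatl icatr delinK. Qed.

Lemma split_modesK (P : 'I_m -> nat) (Q : 'I_n -> nat) :
  cancel (@split_modes R m n P Q) (@merge_modes R m n P Q).
Proof.
move=> C; apply/ffunP=> i; rewrite 2!ffunE icatl icatr delinK -[in RHS](icat_eta i).
by congr (C (icat _ _)); apply/ffunP=> s; rewrite [LHS]ffunE (ord1 s).
Qed.

End TensorUnfoldings.

Lemma mat1B (R : pzRingType) n M (Q : 'I_n -> nat)
    (S T : tensor R (scat (single M) Q)) :
  mat1 (S - T) = mat1 S - mat1 T.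
Proof. by apply/matrixP=> a b; rewrite !mxE ffunE [in LHS]ffunE. Qed.

Lemma mat1_sum (R : pzRingType) n M (Q : 'I_n -> nat) (K : finType) (pr : pred K)
    (T : K -> tensor R (scat (single M) Q)) :
  mat1 (\sum_(k | pr k) T k) = \sum_(k | pr k) mat1 (T k).
Proof.
apply/matrixP=> a b; rewrite mxE sum_ffunE summxE.
by apply: eq_bigr => k _; rewrite mxE.
Qed.

(** * Bilinear least squares *)

Section LeastSquares.
Variable R : rcfType.

Lemma frobenius_sqr m n (A : 'M[R]_(m, n)) : frobenius A ^+ 2 = \tr (A^T *m A).
Proof.
have -> : \tr (A^T *m A) = \sum_(i < m) \sum_(j < n) A i j ^+ 2.
  rewrite exchange_big; apply: eq_bigr => j _; rewrite mxE.
  by apply: eq_bigr => i _; rewrite mxE.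
by rewrite sqr_sqrtr //; do 2!apply: sumr_ge0 => ? _; exact: sqr_ge0.
Qed.

(* Pythagoras: the normal equations make the residual at G orthogonal to the
   range of H |-> Z *m H *m K^T. *)
Lemma least_squares_bilinear m n q r (E : 'M[R]_(m, n)) (Z : 'M[R]_(m, q))
    (K : 'M[R]_(n, r)) (G H : 'M[R]_(q, r)) :
    Z^T *m (E - Z *m G *m K^T) *m K = 0 ->
  frobenius (E - Z *m G *m K^T) ^+ 2 <= frobenius (E - Z *m H *m K^T) ^+ 2.
Proof.
set F := E - Z *m G *m K^T => ZFK.
have -> : E - Z *m H *m K^T = F + Z *m (G - H) *m K^T.
  by rewrite mulmxBr mulmxBl addrA subrK.
set S := Z *m _ *m _.
(* Cyclicity of the trace turns this into tr ((G - H)^T Z^T F K). *)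
have S_F : \tr (S^T *m F) = 0.
  rewrite !trmx_mul trmxK -!mulmxA mxtrace_mulC -!mulmxA.
  by rewrite [Z^T *m _]mulmxA ZFK mulmx0 mxtrace0.
move: F S S_F {ZFK} => F S S_F.
have trD : (F + S)^T = F^T + S^T by exact: raddfD.
rewrite !frobenius_sqr trD mulmxDl !mulmxDr !mxtraceD S_F.
(* The other cross term is the trace of the transpose of the first, so it vanishes too. *)
rewrite -(mxtrace_tr (F^T *m S)) trmx_mul trmxK S_F addr0 add0r lerDl.
by rewrite -frobenius_sqr sqr_ge0.
Qed.

(** The factor in front of the last [Z] is the orthogonal projection onto the column space of [Z].
    The transposed form is the one that meets K in the normal equations. *)
Lemma lsq_left_inverse m q (Z : 'M[R]_(m, q)) :
  Z^T *m Z \in unitmx -> (invmx (Z^T *m Z) *m Z^T)^T *m Z^T *m Z = Z.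
Proof.
move=> Zu; rewrite trmx_mul trmxK trmx_inv trmx_mul trmxK -!mulmxA.
by rewrite mulVmx // mulmx1.
Qed.

End LeastSquares.

Theorem proposition2 (R : realType) (M p d : nat)
  (hM : (1 <= M)%N) (hp : (1 <= p)%N) (hd : (1 <= d)%N)
  (l : 'I_p -> nat)
  (P P' : forall k : 'I_p, 'I_(l k) -> nat) (Q Q' : 'I_d -> nat)
  (Y : tensor R (scat (single M) Q))
  (X : forall k : 'I_p, tensor R (scat (single M) (P k)))
  (U : forall (k : 'I_p) (i : 'I_(l k)), 'M[R]_(P k i, P' k i))
  (V : forall i : 'I_d, 'M[R]_(Q i, Q' i))
  (j : 'I_p)
  (C : forall k : 'I_p, tensor R (scat (P' k) Q')) :
  let B (D : forall k : 'I_p, tensor R (scat (P' k) Q')) (k : 'I_p) :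
      tensor R (scat (P k) Q) := mode_prods (D k) (fcat (U k) V) in
  let Z : 'M[R]_(M, \prod_(i < l j) P' j i) :=
    mat1 (X j) *m rev_kron (U j) in
  let Rj : tensor R (scat (single M) Q) :=
    Y - \sum_(k < p | k != j) contract (X k) (B C k) in
  let objective (D : forall k : 'I_p, tensor R (scat (P' k) Q')) : R :=
    frobenius (mat1 Y - \sum_(k < p) mat1 (X k) *m unfold (B D k)) ^+ 2 in
  let Ctilde : tensor R (scat (single (\prod_(i < l j) P' j i)) Q') :=
    mode_prods Rj
      (fcat (I := single (\prod_(i < l j) P' j i)) (I' := single M)
         (fun=> invmx (Z^T *m Z) *m Z^T)
         (fun i => invmx ((V i)^T *m V i) *m (V i)^T)) in
  let Cstar : tensor R (scat (P' j) Q') := split_modes Ctilde in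
  Z^T *m Z \in unitmx ->
  (forall i : 'I_d, (V i)^T *m V i \in unitmx) ->
  merge_modes Cstar = Ctilde /\
  forall Cj : tensor R (scat (P' j) Q'),
    objective (dfwith C Cstar) <= objective (dfwith C Cj).
Proof.
move=> B Z Rj objective Ctilde Cstar Zu Vu; split; first exact: split_modesK.
move=> Cj; pose K := rev_kron V.
(* Only the term k = j sees [D]; the other terms are the contractions already subtracted in [Rj]. *)
have objE D : objective (dfwith C D)
    = frobenius (mat1 Rj - Z *m unfold D *m K^T) ^+ 2.
  rewrite /objective (bigD1 j) //= {1}/B dfwith_in unfold_mode_prods.
  rewrite /Rj mat1B mat1_sum opprD addrA addrAC !mulmxA; congr (frobenius (_ - _ - _) ^+ 2).
  apply: eq_bigr => k kj; rewrite mat1_contract /B dfwith_out //.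
  by rewrite eq_sym.
rewrite !objE; apply: least_squares_bilinear.
(* From here [Z] is a single opaque matrix, so reassociation cannot reach inside its
   factorization. *)
clearbody Z.
rewrite unfold_split_modes mat1_mode_prods mulmxBr mulmxBl !mulmxA.
rewrite mulmxV // mul1mx.
set L := rev_kron _.
(* Transposition and multiplication act factorwise on Kronecker products, so the claim reduces to
   one about each [V i]. *)
have KL : L^T *m K^T *m K = K.
  rewrite /L /K !trmx_rev_kron !rev_kron_mul; apply: eq_rev_kron => i.
  exact: lsq_left_inverse.
by rewrite -!mulmxA (mulmxA L^T) KL subrr.
Qed.
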